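(* Let $\mathcal{G}$ be an undirected connected graph on $\mathcal{V}=\{1,\dots,N\}$ with adjacency matrix $\mathcal{A}$, let $\mathcal{H}\subseteq\mathcal{V}$ be the set of honest-but-curious (HBC) agents, let $\delta_1^*,\dots,\delta_N^*\in\mathbb{R}^2$ be the desired formation offsets, and for each $i\in\mathcal{V}$ let the constants satisfy $\gamma_i>0$, $0<k_{1i}<1$, $k_{2i}=1-k_{1i}^2$. Suppose the agents evolve, for $i\in\mathcal{V}$ and $t\ge0$, according to $$\begin{aligned}\dot Q_i(t)&=-\big(Q_i(t)-\hat\eta_i(t)-\delta_i^*\big),\\ \dot{\hat\eta}_i(t)&=-\gamma_i\sum_{j\in\mathcal{N}_i}(\hat\eta_i(t)-\hat\eta_j(t))+\big(Q_i(t)-\hat\eta_i(t)-\delta_i^*\big)-k_{1i}\omega_i(t),\\ \dot\omega_i(t)&=k_{1i}\Big(\gamma_i\sum_{j\in\mathcal{N}_i}(\hat\eta_i(t)-\hat\eta_j(t))-\big(Q_i(t)-\hat\eta_i(t)-\delta_i^*\big)\Big)-k_{2i}\omega_i(t),\end{aligned}$$ with states $Q_i(t),\hat\eta_i(t),\omega_i(t)\in\mathbb{R}^2$. Then for every neutral agent $r\in\mathcal{V}\setminus\mathcal{H}$, the privacy of $Q_r(t)$ is preserved against both the HBC adversaries and the external eavesdroppers, even if neighboring HBC adversaries collude.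
   Context: The graph $\mathcal{G}$ has 0/1 symmetric adjacency matrix without self-loops; $\mathcal{N}_i$ is the set of neighbors of node $i$. Agents in $\mathcal{V}\setminus\mathcal{H}$ are called neutral. Each agent $i$ transmits only the signal $\hat\eta_i(t)$ to its neighbors. Formation offsets: given desired positions $\bar Q_1,\dots,\bar Q_N\in\mathbb{R}^2$, $\delta_i^*=\bar Q_i-\frac1N\sum_{j=1}^N\bar Q_j$. Information sets (understood as collections of labeled signals, so that equality means that each corresponding signal coincides): - The information accessible to $h\in\mathcal{H}$ without collusion is $\mathcal{I}_h(t)=\{Q_h(t),\hat\eta_h(t),\omega_h(t),\delta_h^*,\ \hat\eta_l(t)\mid l\in\mathcal{N}_h\}$. - With collusion of neighboring HBC adversaries it is $\mathcal{I}_h^c(t)=\mathcal{I}_h(t)\cup\big(\bigcup_{k\in\mathcal{N}_h\cap\mathcal{H}}\mathcal{I}_k(t)\big)$. - The information accessible to the external eavesdropper is $E^c(t)=\{\mathcal{A}\}\cup\{\hat\eta_i(t)\mid i\in\mathcal{V}\}\cup\{\mathcal{I}_h^c(t)\mid h\in\mathcal{H}\}$. Privacy: let $r\in\mathcal{V}\setminus\mathcal{H}$. Given a solution with initial states $(Q_i(0),\hat\eta_i(0),\omega_i(0))_{i\in\mathcal{V}}$, consider the solution of the same dynamics obtained when the initial states of agent $r$ are changed from $Q_r(0),\hat\eta_r(0),\omega_r(0)$ to $Q_r'(0),\hat\eta_r'(0),\omega_r'(0)$ while the initial states of all other agents are unchanged; primes denote the corresponding trajectories $Q_r'(t)$ and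 information sets $\mathcal{I}_h^{c\prime}(t)$, $E^{c\prime}(t)$. The privacy $Q_r(t)$ of agent $r$ is preserved against the HBC adversaries (respectively, external eavesdroppers) if, for any trajectory $Q_r(t)$ (i.e., for any initial states of all agents), there exists an alternative trajectory $Q_r'(t)$, different from $Q_r(t)$ and obtained by such a change of the initial states of agent $r$, such that $\mathcal{I}_h^c(t)=\mathcal{I}_h^{c\prime}(t)$ for all $h\in\mathcal{H}$ (respectively, $E^c(t)=E^{c\prime}(t)$), for all $t\ge0$. *)

(* Defs.v *)
From HB Require Import structures.
From mathcomp Require Import all_boot all_order all_algebra.
From mathcomp Require Import all_classical all_reals all_analysis.

Set Implicit Arguments.
Unset Strict Implicit.
Unset Printing Implicit Defensive.
Import Order.TTheory GRing.Theory Num.Theory.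
Import numFieldNormedType.Exports.
Local Open Scope classical_set_scope.
Local Open Scope ring_scope.

Definition connected_graph (N : nat) (e : rel 'I_N) : Prop :=
  forall i j : 'I_N, connect e i j.

Definition neighbors (N : nat) (e : rel 'I_N) (i : 'I_N) : {set 'I_N} :=
  [set j | e i j]%SET.

Definition adjacency (R : realType) (N : nat) (e : rel 'I_N) : 'M[R]_N :=
  \matrix_(i, j) (e i j)%:R.

Definition formation_offset (R : realType) (N : nat) (Qbar : 'I_N -> 'rV[R]_2)
    (i : 'I_N) : 'rV[R]_2 :=
  Qbar i - N%:R^-1 *: \sum_(j < N) Qbar j.

(* Only the values at times t >= 0 are meaningful. *)
Record trajectory (R : realType) (N : nat) := Trajectory {
  pos : 'I_N -> R -> 'rV[R]_2 ;   (* Q_i *)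
  est : 'I_N -> R -> 'rV[R]_2 ;   (* \hat\eta_i *)
  aux : 'I_N -> R -> 'rV[R]_2     (* \omega_i *)
}.

(* Derivative relative to the time domain [0, +oo[: the usual derivative at
   t > 0, the right derivative at t = 0. *)
Definition has_deriv_ge0 (R : realType) (f : R -> 'rV[R]_2) (t : R)
    (v : 'rV[R]_2) : Prop :=
  (s - t)^-1 *: (f s - f t) @[s --> within `[0, +oo[ t^'] --> v.

Definition is_solution (R : realType) (N : nat) (e : rel 'I_N)
    (delta : 'I_N -> 'rV[R]_2) (gamma k1 k2 : 'I_N -> R)
    (X : trajectory R N) : Prop :=
  forall (i : 'I_N) (t : R), 0 <= t ->
  let p := pos X i t - est X i t - delta i in
  let c := gamma i *: \sum_(j in neighbors e i) (est X i t - est X j t) in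
  [/\ has_deriv_ge0 (pos X i) t (- p),
      has_deriv_ge0 (est X i) t (- c + p - k1 i *: aux X i t) &
      has_deriv_ge0 (aux X i) t (k1 i *: (c - p) - k2 i *: aux X i t)].

(* Values carry the label of the signal they come from, so that two information
   sets are equal iff all their corresponding signals coincide. *)
Inductive signal (R : realType) (N : nat) :=
| SigPos of 'I_N & 'rV[R]_2
| SigEst of 'I_N & 'rV[R]_2
| SigAux of 'I_N & 'rV[R]_2
| SigOffset of 'I_N & 'rV[R]_2.

Definition info (R : realType) (N : nat) (e : rel 'I_N)
    (delta : 'I_N -> 'rV[R]_2) (X : trajectory R N) (h : 'I_N) (t : R) :
    set (signal R N) :=
  [set SigPos h (pos X h t); SigEst h (est X h t); SigAux h (aux X h t);
       SigOffset h (delta h)]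
  `|` [set SigEst l (est X l t) | l in [set` neighbors e h]].

Definition info_collusion (R : realType) (N : nat) (e : rel 'I_N)
    (H : {set 'I_N}) (delta : 'I_N -> 'rV[R]_2) (X : trajectory R N)
    (h : 'I_N) (t : R) : set (signal R N) :=
  info e delta X h t
  `|` \bigcup_(k in [set` (neighbors e h :&: H)%SET]) info e delta X k t.

Inductive eavesdropped (R : realType) (N : nat) :=
| EavAdjacency of 'M[R]_N
| EavEst of 'I_N & 'rV[R]_2
| EavInfo of 'I_N & set (signal R N).

Definition info_eavesdropper (R : realType) (N : nat) (e : rel 'I_N)
    (H : {set 'I_N}) (delta : 'I_N -> 'rV[R]_2) (X : trajectory R N) (t : R) :
    set (eavesdropped R N) :=
  [set EavAdjacency (adjacency R e)]
  `|` [set EavEst i (est X i t) | i in [set: 'I_N]]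
  `|` [set EavInfo h (info_collusion e H delta X h t) | h in [set` H]].

Definition same_initial_states_except (R : realType) (N : nat) (r : 'I_N)
    (X X' : trajectory R N) : Prop :=
  forall i : 'I_N, i != r ->
  [/\ pos X' i 0 = pos X i 0, est X' i 0 = est X i 0 & aux X' i 0 = aux X i 0].

(* [indist X X' t]: the adversaries' information at time t is the same along
   X and X'. *)
Definition privacy_preserved (R : realType) (N : nat)
    (sol : trajectory R N -> Prop)
    (indist : trajectory R N -> trajectory R N -> R -> Prop) (r : 'I_N) :
    Prop :=
  forall X : trajectory R N, sol X ->
  exists X' : trajectory R N,
    [/\ sol X',
        same_initial_states_except r X X',
        exists2 t : R, 0 <= t & pos X' r t <> pos X r t &
        forall t : R, 0 <= t -> indist X X' t].

Definition privacy_against_HBC (R : realType) (N : nat) (e : rel 'I_N)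
    (H : {set 'I_N}) (delta : 'I_N -> 'rV[R]_2) (gamma k1 k2 : 'I_N -> R)
    (r : 'I_N) : Prop :=
  privacy_preserved (is_solution e delta gamma k1 k2)
    (fun X X' t => forall h : 'I_N, h \in H ->
       info_collusion e H delta X h t = info_collusion e H delta X' h t) r.

Definition privacy_against_eavesdropper (R : realType) (N : nat)
    (e : rel 'I_N) (H : {set 'I_N}) (delta : 'I_N -> 'rV[R]_2)
    (gamma k1 k2 : 'I_N -> R) (r : 'I_N) : Prop :=
  privacy_preserved (is_solution e delta gamma k1 k2)
    (fun X X' t =>
       info_eavesdropper e H delta X t = info_eavesdropper e H delta X' t) r.

(* Main.v *)
(** Adding [expR (- t) *: a] to [Q_r] and [(k1 r)^-1 *: expR (- t) *: a] to
    [omega_r] changes nothing in the equation of [\hat\eta_r], because the two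
    contributions [p] and [- k1 r *: omega_r] cancel; and the equation of
    [omega_r] still holds because [k1 r ^+ 2 + k2 r = 1], so that the
    perturbation decays at the same rate [1] in both states. All the transmitted
    signals [\hat\eta_i] are therefore unchanged. *)
Require Import Defs.
From HB Require Import structures.
From mathcomp Require Import all_boot all_order all_algebra.
From mathcomp Require Import all_classical all_reals all_analysis.
From mathcomp Require Import ring.
Import Order.TTheory GRing.Theory Num.Theory.
Import numFieldNormedType.Exports.
Local Open Scope ring_scope.

Lemma has_deriv_ge0D (R : realType) (f g : R -> 'rV[R]_2) (t : R)
    (u v : 'rV[R]_2) :
  has_deriv_ge0 f t u -> has_deriv_ge0 g t v ->
  has_deriv_ge0 (fun s => f s + g s) t (u + v).
Proof.
rewrite /has_deriv_ge0 => fu gv.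
under eq_fun do rewrite opprD addrACA scalerDr.
exact: cvgD.
Qed.

(** By Carathéodory, [f s - f t] is [g s * (s - t)] with [g] continuous at [t], so away from [t] the
    quotient is [g s *: a]; its limit along [t^'] passes to the smaller filter within [[0, +oo[]. *)
Lemma is_derive_has_deriv_ge0 (R : realType) (f : R -> R) (t l : R)
    (a : 'rV[R]_2) :
  is_derive t 1 f l -> has_deriv_ge0 (fun s => f s *: a) t (l *: a).
Proof.
move=> /is_derive1_caratheodory[g [fE g_cont <-]].
apply: (cvg_trans (cvg_app _ (cvg_within _))).
have /(cvg_trans _) : (g s *: a @[s --> t^'] --> g t *: a)%classic.
  by apply: cvgZr_tmp; apply: (cvg_trans (cvg_app _ (cvg_within _))).
apply; apply: near_eq_cvg.
near=> s.
have st : s - t != 0 by rewrite subr_eq0; near: s; exact: nbhs_dnbhs_neq.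
by rewrite -scalerBl fE scalerA mulrCA mulVf// mulr1.
Unshelve. all: by end_near. Qed.

Lemma has_deriv_ge0_expRN (R : realType) (t : R) (a : 'rV[R]_2) :
  has_deriv_ge0 (fun s => expR (- s) *: a) t (- (expR (- t) *: a)).
Proof.
rewrite -scaleNr; apply: is_derive_has_deriv_ge0.
by apply: is_derive_eq; rewrite mulrN1.
Qed.

(** Indexing [a] by agents spares the dynamics any case split on [r]: the choice of who is perturbed
    is left to the support of [a]. *)
Definition perturb (R : realType) (N : nat) (k1 : 'I_N -> R)
    (a : 'I_N -> 'rV[R]_2) (X : trajectory R N) : trajectory R N :=
  Trajectory (fun i t => pos X i t + expR (- t) *: a i)
             (est X)
             (fun i t => aux X i t + expR (- t) *: ((k1 i)^-1 *: a i)).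

Arguments perturb {R N}.

Lemma perturb_is_solution (R : realType) (N : nat) (e : rel 'I_N)
    (delta : 'I_N -> 'rV[R]_2) (gamma k1 k2 : 'I_N -> R)
    (a : 'I_N -> 'rV[R]_2) (X : trajectory R N) :
  (forall i, k1 i != 0) -> (forall i, k2 i = 1 - k1 i ^+ 2) ->
  is_solution e delta gamma k1 k2 X ->
  is_solution e delta gamma k1 k2 (perturb k1 a X).
Proof.
move=> k1_neq0 k2E solX i t t_ge0 p' c.
have [dpos dest daux] := solX i t t_ge0.
set p := pos X i t - est X i t - delta i in dpos dest daux.
have p'E : p' = p + expR (- t) *: a i.
  by rewrite /p' /p /= -!addrA (addrC (expR _ *: _)) !addrA.
(* [c] involves only [est], so it is convertible to the corresponding term of [X]. *)
rewrite p'E; split.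
- by rewrite opprD; apply: has_deriv_ge0D => //; exact: has_deriv_ge0_expRN.
- rewrite (_ : _ - _ = - c + p - k1 i *: aux X i t)//.
  by apply/rowP => j; rewrite /= !mxE; field; exact: k1_neq0.
- rewrite (_ : _ - _ = k1 i *: (c - p) - k2 i *: aux X i t -
                       expR (- t) *: ((k1 i)^-1 *: a i)).
    exact: has_deriv_ge0D (has_deriv_ge0_expRN _ _ _).
  (* Coordinatewise this is [k1 i + k2 i / k1 i = 1 / k1 i]. *)
  by apply/rowP => j; rewrite k2E !mxE; field; exact: k1_neq0.
Qed.

Lemma info_perturb (R : realType) (N : nat) (e : rel 'I_N)
    (delta : 'I_N -> 'rV[R]_2) (k1 : 'I_N -> R) (a : 'I_N -> 'rV[R]_2)
    (X : trajectory R N) (h : 'I_N) (t : R) :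
  a h = 0 -> info e delta (perturb k1 a X) h t = info e delta X h t.
Proof. by move=> ah0; rewrite /info /= ah0 !scaler0 !addr0. Qed.

(** Positions and auxiliary states enter only for agents of [H], where [a] vanishes; any other agent
    is seen through [est] alone. *)
Lemma info_collusion_perturb (R : realType) (N : nat) (e : rel 'I_N)
    (H : {set 'I_N}) (delta : 'I_N -> 'rV[R]_2) (k1 : 'I_N -> R)
    (a : 'I_N -> 'rV[R]_2) (X : trajectory R N) (h : 'I_N) (t : R) :
  {in H, forall k, a k = 0} -> h \in H ->
  info_collusion e H delta (perturb k1 a X) h t =
  info_collusion e H delta X h t.
Proof.
move=> aH0 hH; rewrite /info_collusion info_perturb ?aH0//.
congr setU; apply: eq_bigcupr => k /=; rewrite inE => /andP[_ kH].
by rewrite info_perturb ?aH0.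
Qed.

(** Keeping [indist] abstract lets both kinds of adversary share one alternative trajectory. *)
Lemma privacy_preserved_perturb (R : realType) (N : nat) (e : rel 'I_N)
    (H : {set 'I_N}) (delta : 'I_N -> 'rV[R]_2) (gamma k1 k2 : 'I_N -> R)
    (indist : trajectory R N -> trajectory R N -> R -> Prop) (r : 'I_N) :
  (forall i, k1 i != 0) -> (forall i, k2 i = 1 - k1 i ^+ 2) -> r \notin H ->
  (forall a X t, {in H, forall k, a k = 0} ->
    indist X (perturb k1 a X) t) ->
  privacy_preserved (is_solution e delta gamma k1 k2) indist r.
Proof.
move=> k1_neq0 k2E rH indistP X solX.
pose a (i : 'I_N) : 'rV[R]_2 := if i == r then const_mx 1 else 0.
exists (perturb k1 a X); split.
- exact: perturb_is_solution.
- by move=> i /negbTE ir; rewrite /= /a ir !scaler0 !addr0.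
(* The positions already differ at time 0, by [a r], whose first coordinate is 1. *)
- exists 0 => //=; rewrite oppr0 expR0 scale1r /a eqxx => /rowP/(_ ord0)/eqP.
  by rewrite !mxE -[eqbRHS]addr0 (inj_eq (addrI _)) oner_eq0.
- move=> t _; apply: indistP => k kH; rewrite /a ifN//.
  by apply: contraNneq rH => <-.
Qed.

Theorem theorem3 (R : realType) (N : nat) (e : rel 'I_N)
    (e_sym : symmetric e) (e_irr : irreflexive e) (e_conn : connected_graph e)
    (H : {set 'I_N}) (Qbar : 'I_N -> 'rV[R]_2) (gamma k1 k2 : 'I_N -> R)
    (gamma_gt0 : forall i : 'I_N, 0 < gamma i)
    (k1_itv : forall i : 'I_N, 0 < k1 i < 1)
    (k2E : forall i : 'I_N, k2 i = 1 - k1 i ^+ 2)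
    (r : 'I_N) (r_neutral : r \notin H) :
  privacy_against_HBC e H (formation_offset Qbar) gamma k1 k2 r /\
  privacy_against_eavesdropper e H (formation_offset Qbar) gamma k1 k2 r.
Proof.
have k1_neq0 i : k1 i != 0 by have /andP[/lt0r_neq0] := k1_itv i.
split; apply: (@privacy_preserved_perturb _ _ _ H) => // a X t aH0.
  by move=> h hH; rewrite info_collusion_perturb.
(* The adjacency matrix and the [est] signals agree by conversion; only the collusion sets
   remain. *)
congr setU; apply: eq_imagel => h hH.
by rewrite info_collusion_perturb.
Qed.
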